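(* Let $X,Y$ be normed spaces, let $g:X\to Y$ be calm at $\bar x$, and let $\varphi:X\times Y\to(-\infty,\infty]$ be finite at $(\bar x,\bar y)$ with $\bar y:=g(\bar x)$. Assume that $\varphi$ is Fréchet differentiable at $(\bar x,\bar y)$ with $\nabla\varphi(\bar x,\bar y)=(\nabla_x\varphi(\bar x,\bar y),\nabla_y\varphi(\bar x,\bar y))$. Then the generalized composition $(\varphi\circ g)(x):=\varphi(x,g(x))$, $x\in X$, satisfies $$\widehat\partial(\varphi\circ g)(\bar x)=\nabla_x\varphi(\bar x,\bar y)+\widehat D^*g(\bar x)\big(\nabla_y\varphi(\bar x,\bar y)\big)=\nabla_x\varphi(\bar x,\bar y)+\widehat\partial\langle\nabla_y\varphi(\bar x,\bar y),g\rangle(\bar x),$$ $$\widehat\partial^{\infty}(\varphi\circ g)(\bar x)=\{0\}.$$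
   Context: All spaces are normed; $X^*$ is the topological dual of $X$; $\mathbb B(\bar x,r)$ is the open ball; product spaces carry the sum norm, e.g. $\|(x,y)\|=\|x\|+\|y\|$. For an extended-real-valued $f$ on $Z$, $\operatorname{epi}f=\{(z,\alpha)\in Z\times\mathbb R\mid\alpha\ge f(z)\}$. For $y^*\in Y^*$, $\langle y^*,g\rangle$ denotes the function $x\mapsto\langle y^*,g(x)\rangle$. Calmness: $g:X\to Y$ is calm at $\bar x$ if there are $r>0$, $\ell\ge0$ with $\|g(x)-g(\bar x)\|\le\ell\|x-\bar x\|$ for all $x\in\mathbb B(\bar x,r)$. Regular subdifferential: for $f$ finite at $\bar z$, $\widehat\partial f(\bar z)$ is the set of $z^*\in Z^*$ such that for every $\varepsilon>0$ there is $\gamma>0$ with $f(z)-f(\bar z)-\langle z^*,z-\bar z\rangle\ge-\varepsilon\|z-\bar z\|$ for all $z\in\mathbb B(\bar z,\gamma)$. Regular normal cone: for $S\subset Z$ and $\bar z\in S$, $\widehat N(\bar z;S)=\{z^*\in Z^*\mid \limsup_{z\to\bar z,\,z\in S}\langle z^*,\frac{z-\bar z}{\|z-\bar z\|}\rangle\le0\}$. Singular regular subdifferential: $\widehat\partial^{\infty}f(\bar z)=\{z^*\in Z^*\mid(z^*,0)\in\widehat N((\bar z,f(\bar z));\operatorname{epi}f)\}$. Regular coderivative of the single-valued $g$: $\widehat D^*g(\bar x)(y^* )=\{x^*\in X^*\mid(x^*,-y^* )\in\widehat N((\bar x,g(\bar x));\operatorname{gph}g)\}$, where $\operatorname{gph}g=\{(x,y)\mid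 y=g(x)\}$. *)

(* Defs.v *)
From HB Require Import structures.
From mathcomp Require Import all_boot all_order all_algebra.
From mathcomp Require Import all_classical all_reals all_analysis.

Set Implicit Arguments.
Unset Strict Implicit.
Unset Printing Implicit Defensive.

Import Order.TTheory GRing.Theory Num.Theory.
Import numFieldNormedType.Exports.

Local Open Scope classical_set_scope.
Local Open Scope ring_scope.

Definition dual (R : realType) (Z : normedModType R) : set (Z -> R^o) :=
  [set zs | linear zs /\ continuous zs].

(* The functional (us, vs) on U * V, under the identification
   (U * V)^* = U^* * V^*. *)
Definition dual_pair (R : realType) (U V : normedModType R)
    (us : U -> R^o) (vs : V -> R^o) : U * V -> R^o :=
  fun w => us w.1 + vs w.2.

(* The library's norm on U * V is the maximum norm; it induces the same
   topology as sum_norm. *)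
Definition sum_norm (R : realType) (U V : normedModType R) (w : U * V) : R :=
  `|w.1| + `|w.2|.

Definition calm (R : realType) (X Y : normedModType R) (g : X -> Y)
    (xbar : X) : Prop :=
  exists r l : R, [/\ 0 < r, 0 <= l &
    forall x, ball xbar r x -> `|g x - g xbar| <= l * `|x - xbar|].

(* Meant for f finite at zbar. *)
Definition regular_subdiff (R : realType) (Z : normedModType R)
    (f : Z -> \bar R) (zbar : Z) : set (Z -> R^o) :=
  [set zs | dual zs /\
    forall eps : R, 0 < eps -> exists2 gamma : R, 0 < gamma &
      forall z, ball zbar gamma z ->
        ((- (eps * `|z - zbar|))%:E <= f z - f zbar - (zs (z - zbar))%:E)%E].

(* Meant for wbar in S.  The filter is that of w --> wbar with w in S and
   w <> wbar. *)
Definition regular_normal_cone (R : realType) (U V : normedModType R)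
    (wbar : U * V) (S : set (U * V)) : set (U * V -> R^o) :=
  [set ws | dual ws /\
    (limf_esup (fun w : U * V =>
         (ws ((@sum_norm R U V (w - wbar))^-1 *: (w - wbar)))%:E)
       (within S wbar^') <= 0)%E].

Definition epi (R : realType) (Z : normedModType R) (f : Z -> \bar R) :
    set (Z * R^o) :=
  [set p | (f p.1 <= (p.2)%:E)%E].

Definition gph (R : realType) (X Y : normedModType R) (g : X -> Y) :
    set (X * Y) :=
  [set p | p.2 = g p.1].

(* Meant for f finite at zbar. *)
Definition singular_regular_subdiff (R : realType) (Z : normedModType R)
    (f : Z -> \bar R) (zbar : Z) : set (Z -> R^o) :=
  [set zs | dual zs /\
    regular_normal_cone (zbar, fine (f zbar) : R^o) (epi f)
      (dual_pair zs (fun _ : R^o => 0))].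

Definition regular_coderiv (R : realType) (X Y : normedModType R)
    (g : X -> Y) (xbar : X) (ys : Y -> R^o) : set (X -> R^o) :=
  [set xs | dual xs /\
    regular_normal_cone (xbar, g xbar) (gph g)
      (dual_pair xs (fun y => - ys y))].

(* Frechet differentiability of an extended-real-valued function; it forces
   finiteness around zbar, where f agrees with fine \o f. *)
Definition ediff (R : realType) (Z : normedModType R) (f : Z -> \bar R)
    (zbar : Z) : Prop :=
  (\forall z \near zbar, f z \is a fin_num) /\
  differentiable (fine \o f : Z -> R^o) zbar.

Definition gradient (R : realType) (Z : normedModType R) (f : Z -> \bar R)
    (zbar : Z) : Z -> R^o :=
  'd (fine \o f : Z -> R^o) zbar.

Definition gradient_x (R : realType) (X Y : normedModType R)
    (phi : X * Y -> \bar R) (z : X * Y) : X -> R^o :=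
  fun h => gradient phi z (h, 0).

Definition gradient_y (R : realType) (X Y : normedModType R)
    (phi : X * Y -> \bar R) (z : X * Y) : Y -> R^o :=
  fun k => gradient phi z (0, k).

Definition gen_comp (R : realType) (X Y : normedModType R)
    (phi : X * Y -> \bar R) (g : X -> Y) : X -> \bar R :=
  fun x => phi (x, g x).

Definition scalarization (R : realType) (X Y : normedModType R)
    (ys : Y -> R^o) (g : X -> Y) : X -> \bar R :=
  fun x => (ys (g x))%:E.

Definition translate (R : realType) (X : normedModType R) (xs : X -> R^o)
    (A : set (X -> R^o)) : set (X -> R^o) :=
  [set (fun h => xs h + us h) | us in A].

(* Main.v *)
(* Write a and b for the partial gradients of phi.  Calmness of g turns the
   o(||(x, g x) - z||) remainder in the expansion of phi at z = (xbar, g xbar)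
   into o(||x - xbar||), so x |-> phi (x, g x) differs from a + <b, g> by a
   constant and an o(||x - xbar||), which leaves regular subgradients
   unchanged.  Calmness also makes the norms of x - xbar and of
   (x, g x) - z comparable, whence the coderivative at b is the subdifferential
   of <b, g>.  Finally the composition is calm at xbar, and this rules out
   nonzero singular subgradients. *)
Require Import Defs.
From HB Require Import structures.
From mathcomp Require Import all_boot all_order all_algebra.
From mathcomp Require Import all_classical all_reals all_analysis.
From mathcomp Require Import ring lra.

Set Implicit Arguments.
Unset Strict Implicit.
Unset Printing Implicit Defensive.

Import Order.TTheory GRing.Theory Num.Theory.
Import numFieldNormedType.Exports.
Local Open Scope classical_set_scope.
Local Open Scope ring_scope.

(** * Upper limits and continuous linear functionals *)

Lemma limf_esup_le0P (R : realType) (T : topologicalType) (F : set_system T)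
    (f : T -> R) : Filter F ->
  (limf_esup (EFin \o f) F <= 0)%E <->
  forall e : R, 0 < e -> \forall x \near F, f x <= e.
Proof.
move=> FF; split=> [f0 e e0|f_le].
- have [_ [V FV <-] Ve] : exists2 y, [set ereal_sup ((EFin \o f) @` V) | V in F] y
      & (y < e%:E)%E.
    by apply: ereal_inf_lt; apply: le_lt_trans f0 _; rewrite lte_fin.
  apply: filterS FV => x Vx; rewrite -lee_fin; apply: le_trans (ltW Ve).
  by apply: ereal_sup_ubound; exists x.
- apply/lee_addgt0Pr => e e0; rewrite add0e.
  (* The sublevel set at height [e] belongs to the filter, and the supremum over it is at most
     [e]. *)
  apply: ge_ereal_inf; exists (ereal_sup ((EFin \o f) @` [set x | f x <= e])).
    by exists [set x | f x <= e] => //; exact: f_le.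
  by apply: ge_ereal_sup => _ [x fx <-]; rewrite lee_fin.
Qed.

Section dual.
Variables (R : realType) (Z : normedModType R).
Implicit Types zs us : Z -> R^o.

(** Repackages the predicate as a bundled linear map, so that the generic lemmas on linear maps can
    rewrite with it. *)
Lemma dual_linearPZ zs : dual zs ->
  exists L : {linear Z -> R^o}, zs = L /\ continuous L.
Proof.
move=> [lin_zs cont_zs].
pose L : {linear Z -> R^o} := HB.pack zs (GRing.isLinear.Build _ _ _ _ zs lin_zs).
by exists L.
Qed.

Lemma linear_dual (L : {linear Z -> R^o}) : continuous L -> dual L.
Proof. by move=> cL; split=> //; exact: linearP. Qed.

Lemma dual_bounded zs : dual zs ->
  exists2 M : R, 0 < M & forall z, `|zs z| <= M * `|z|.
Proof.
move=> /dual_linearPZ[L [-> cL]].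
by move/linear_bounded_continuous/linear_boundedP/pinfty_ex_gt0: cL.
Qed.

Lemma dualD zs us : dual zs -> dual us ->
  dual (fun z => zs z + us z).
Proof.
move=> [lz cz] [lu cu]; split=> [a x y|x].
  by rewrite lz lu scalerDr addrACA.
by apply: continuousD; [exact: cz|exact: cu].
Qed.

Lemma dualN zs : dual zs -> dual (fun z => - zs z).
Proof.
move=> [lz cz]; split=> [a x y|x]; first by rewrite lz opprD scalerN.
by apply: continuousN; exact: cz.
Qed.

Lemma dual0 : dual (fun _ : Z => 0 : R^o).
Proof.
by split=> [a x y|]; [rewrite scaler0 addr0 | move=> x; exact: cst_continuous].
Qed.

End dual.

Lemma dual_dual_pair (R : realType) (U V : normedModType R)
    (us : U -> R^o) (vs : V -> R^o) : dual us -> dual vs ->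
  dual (dual_pair us vs).
Proof.
move=> [lu cu] [lv cv]; split=> [a x y|x].
  by rewrite /dual_pair/= lu lv scalerDr addrACA.
apply: continuousD.
  by apply: continuous_comp; [exact: cvg_fst|exact: cu].
by apply: continuous_comp; [exact: cvg_snd|exact: cv].
Qed.

(** * Normal cones and subdifferentials in epsilon form *)

Lemma sum_norm_gt0 (R : realType) (U V : normedModType R) (w : U * V) :
  w != 0 -> 0 < sum_norm w.
Proof.
move=> w0; rewrite lt_neqAle addr_ge0// andbT eq_sym paddr_eq0// !normr_eq0.
by apply: contra w0; case: w => u v /= /andP[/eqP-> /eqP->].
Qed.

(** By linearity the positive factor [sum_norm (w - wbar)] can be cleared from the quotient. At
    [w = wbar] both sides of the cleared inequality vanish, so the punctured neighbourhood may be
    replaced by a full one. *)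
Lemma regular_normal_coneP (R : realType) (U V : normedModType R)
    (wbar : U * V) (S : set (U * V)) (ws : U * V -> R^o) :
  regular_normal_cone wbar S ws <->
  dual ws /\ forall e : R, 0 < e -> \forall w \near (wbar : U * V),
    S w -> ws (w - wbar) <= e * sum_norm (w - wbar).
Proof.
suff H : dual ws ->
    ((limf_esup (fun w : U * V => (ws ((sum_norm (w - wbar))^-1 *: (w - wbar)))%:E)
       (within S wbar^') <= 0)%E <->
    forall e : R, 0 < e -> \forall w \near wbar,
      S w -> ws (w - wbar) <= e * sum_norm (w - wbar)).
  by split=> -[dws ?]; split=> //; exact/H.
move=> /dual_linearPZ[L [-> _]].
rewrite (limf_esup_le0P (fun w : U * V => L ((sum_norm (w - wbar))^-1 *: (w - wbar)))).
have E e (w : U * V) : w != wbar ->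
    (L ((sum_norm (w - wbar))^-1 *: (w - wbar)) <= e) =
    (L (w - wbar) <= e * sum_norm (w - wbar)).
  move=> wwbar; rewrite linearZ /= -[_ *: _]/(_ * _) mulrC ler_pdivrMr//.
  by rewrite sum_norm_gt0// subr_eq0.
split=> H e e0; have := H e e0.
  move=> He; near=> w => Sw.
  have [->|wwbar] := eqVneq w wbar.
    by rewrite subrr linear0 /sum_norm/= normr0 normr0 addr0 mulr0.
  rewrite -E//; move: wwbar Sw; near: w; exact: He.
move=> He; rewrite near_withinE /dnbhs near_withinE.
by apply: filterS He => w He wwbar Sw; rewrite E//; exact: He.
Unshelve. all: by end_near. Qed.

Lemma regular_subdiff_EFinP (R : realType) (Z : normedModType R)
    (f : Z -> \bar R) (zbar : Z) (zs : Z -> R^o) :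
  (\forall z \near zbar, f z \is a fin_num) ->
  regular_subdiff f zbar zs <->
  dual zs /\ forall e : R, 0 < e -> \forall z \near zbar,
    - (e * `|z - zbar|) <= fine (f z) - fine (f zbar) - zs (z - zbar).
Proof.
move=> ffin; have fzbar := nbhs_singleton ffin.
have E e z : f z \is a fin_num ->
    ((- (e * `|z - zbar|))%:E <= f z - f zbar - (zs (z - zbar))%:E)%E =
    (- (e * `|z - zbar|) <= fine (f z) - fine (f zbar) - zs (z - zbar)).
  by move=> fz; rewrite -[in LHS](fineK fz) -[in LHS](fineK fzbar) lee_fin.
split=> -[dzs H]; split=> // e e0.
  have [r r0 Hr] := H e e0.
  near=> z; rewrite -E; last by near: z.
  by apply: Hr; near: z; exact: nbhsx_ballx.
have /nbhs_ballP[r r0 Hr] :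
    \forall z \near zbar, f z \is a fin_num /\
      - (e * `|z - zbar|) <= fine (f z) - fine (f zbar) - zs (z - zbar).
  by near=> z; split; near: z => //; exact: H.
by exists r => // z /Hr[fz]; rewrite E.
Unshelve. all: by end_near. Qed.

(** Up to a constant, [f] is [a + h] plus an error that is o(||z - zbar||). Hence [zs] is a
    subgradient of [f] exactly when [zs - a] is one of [h]: half of [e] pays for the error, half for
    the subgradient inequality. *)
Lemma regular_subdiff_translate (R : realType) (Z : normedModType R)
    (f : Z -> \bar R) (h : Z -> R) (a : Z -> R^o) (zbar : Z) :
  dual a -> (\forall z \near zbar, f z \is a fin_num) ->
  (forall e : R, 0 < e -> \forall z \near zbar,
    `|fine (f z) - fine (f zbar) - a (z - zbar) - (h z - h zbar)|
      <= e * `|z - zbar|) ->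
  regular_subdiff f zbar = translate a (regular_subdiff (EFin \o h) zbar).
Proof.
move=> da ffin fh.
have hfin : \forall z \near zbar, (EFin \o h) z \is a fin_num by near=> z.
apply/seteqP; split=> zs.
  move=> /(regular_subdiff_EFinP _ ffin)[dzs Hzs].
  exists (fun z => zs z - a z); last by apply/funext => z /=; rewrite addrC subrK.
  apply/(regular_subdiff_EFinP _ hfin).
  split; first exact: dualD dzs (dualN da).
  move=> e e0; have e20 : 0 < e / 2 by rewrite divr_gt0.
  near=> z => /=.
  have : - (e / 2 * `|z - zbar|) <= fine (f z) - fine (f zbar) - zs (z - zbar).
    by near: z; exact: Hzs.
  have : `|fine (f z) - fine (f zbar) - a (z - zbar) - (h z - h zbar)|
      <= e / 2 * `|z - zbar| by near: z; exact: fh.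
  rewrite ler_norml => /andP[]; move: `|z - zbar| => n; lra.
move=> [us /(regular_subdiff_EFinP _ hfin)[dus Hus] <-].
apply/(regular_subdiff_EFinP _ ffin).
split; first exact: dualD.
move=> e e0; have e20 : 0 < e / 2 by rewrite divr_gt0.
near=> z.
have : - (e / 2 * `|z - zbar|) <= h z - h zbar - us (z - zbar).
  by near: z; exact: Hus.
have : `|fine (f z) - fine (f zbar) - a (z - zbar) - (h z - h zbar)|
    <= e / 2 * `|z - zbar| by near: z; exact: fh.
rewrite ler_norml => /andP[]; move: `|z - zbar| => n; lra.
Unshelve. all: by end_near. Qed.

(** * Calm maps and the scalarization of their coderivative *)

Section calm.
Variables (R : realType) (X Y : normedModType R) (g : X -> Y) (xbar : X).
Hypothesis g_calm : calm g xbar.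

Lemma calm_near : exists2 l : R, 0 <= l &
  \forall x \near xbar, `|g x - g xbar| <= l * `|x - xbar|.
Proof.
have [r [l [r0 l0 H]]] := g_calm; exists l => //.
by near=> x; apply: H; near: x; exact: nbhsx_ballx.
Unshelve. all: by end_near. Qed.

Lemma calm_cvg : g x @[x --> xbar] --> g xbar.
Proof.
have [l l0 gl] := calm_near.
apply/cvgrPdist_le => e e0; near=> x; rewrite distrC.
have /le_trans->// : `|g x - g xbar| <= l * `|x - xbar| by near: x.
(* The denominator [l + 1] stays positive when [l = 0]. *)
have : `|x - xbar| <= e / (l + 1).
  rewrite distrC; near: x; apply: cvgr_dist_le; first exact: cvg_id.
  by rewrite divr_gt0// ltr_wpDl.
rewrite ler_pdivlMr ?ltr_wpDl// mulrDr mulr1 mulrC.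
by apply: le_trans; rewrite lerDl.
Unshelve. all: by end_near. Qed.

Lemma calm_cvg_graph : (x, g x) @[x --> xbar] --> (xbar, g xbar).
Proof. by apply: cvg_pair; [exact: cvg_id|exact: calm_cvg]. Qed.

(** At a graph point the pairing equals [xs (x - xbar) - ys (g x - g xbar)], and for [x] near [xbar]
    the sum norm of the increment lies between [|x - xbar|] and [(1 + l) * |x - xbar|]. The upper
    bound turns normals into subgradients, the lower bound does the converse. *)
Lemma regular_coderiv_scalarization (ys : Y -> R^o) : dual ys ->
  regular_coderiv g xbar ys = regular_subdiff (scalarization ys g) xbar.
Proof.
move=> dys; have [L [ysL cL]] := dual_linearPZ dys.
have [l l0 gl] := calm_near.
have sfin : \forall x \near xbar, scalarization ys g x \is a fin_num.
  by near=> x.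
apply/seteqP; split=> xs.
  move=> [dxs /regular_normal_coneP[_ Hxs]].
  apply/(regular_subdiff_EFinP _ sfin); split=> // e e0.
  have l1 : 0 < 1 + l by rewrite ltr_wpDr.
  have el : 0 < e / (1 + l) by rewrite divr_gt0.
  have Hx := calm_cvg_graph (Hxs _ el).
  near=> x => /=; rewrite ysL -linearB -ysL.
  have : dual_pair xs (fun y => - ys y) ((x, g x) - (xbar, g xbar))
      <= e / (1 + l) * sum_norm ((x, g x) - (xbar, g xbar)).
    have : gph g (x, g x) by [].
    by near: x; exact: Hx.
  rewrite /dual_pair /sum_norm /= => H.
  suff : xs (x - xbar) - ys (g x - g xbar) <= e * `|x - xbar| by lra.
  apply: le_trans H _.
  rewrite mulrAC ler_pdivrMr// -mulrA ler_wpM2l ?(ltW e0)//.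
  by rewrite mulrDr mulr1 lerD2l mulrC; near: x.
move=> /(regular_subdiff_EFinP _ sfin)[dxs Hxs]; split=> //.
apply/regular_normal_coneP; split; first exact/dual_dual_pair/dualN.
(* The subgradient inequality involves only [w.1], so it is pulled back along the first projection
   to a neighbourhood of the pair. *)
move=> e e0; have Hw := cvg_fst (G := nbhs (g xbar)) (Hxs e e0).
near=> w => wg.
have : - (e * `|w.1 - xbar|) <= ys (g w.1) - ys (g xbar) - xs (w.1 - xbar).
  by near: w; exact: Hw.
have := mulr_ge0 (ltW e0) (normr_ge0 (w.2 - g xbar)).
rewrite /dual_pair /sum_norm /= wg ysL linearB mulrDr; lra.
Unshelve. all: by end_near. Qed.

End calm.

(** * First-order expansion of the composition *)

Lemma differentiable_near (R : realType) (V W : normedModType R) (f : V -> W)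
    (z : V) : differentiable f z ->
  forall e : R, 0 < e -> \forall w \near z,
    `|f w - f z - 'd f z (w - z)| <= e * `|w - z|.
Proof.
move=> df e e0.
have /eqaddoP/(_ _ e0) H := diff_locally df.
rewrite (near_shift 0) subr0; apply: filterS H => w /=.
by rewrite opprD addrA /= addrK.
Qed.

Section composition.
Variables (R : realType) (X Y : normedModType R) (g : X -> Y) (xbar : X).
Variable (phi : X * Y -> \bar R).
Hypothesis g_calm : calm g xbar.
Hypothesis dphi : ediff phi (xbar, g xbar).

Let z := (xbar, g xbar).

Lemma gradient_dual : dual (gradient phi z).
Proof. by apply: linear_dual; apply: diff_continuous; case: dphi. Qed.

Lemma gradient_x_dual : dual (gradient_x phi z).
Proof.
have [lG cG] := gradient_dual; split=> [a u v|u].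
  rewrite /gradient_x -lG; congr (gradient phi z (_, _)).
  by rewrite /= scaler0 addr0.
apply: continuous_comp; last exact: cG.
by apply: cvg_pair; [exact: cvg_id|exact: cvg_cst].
Qed.

Lemma gradient_y_dual : dual (gradient_y phi z).
Proof.
have [lG cG] := gradient_dual; split=> [a u v|u].
  rewrite /gradient_y -lG; congr (gradient phi z (_, _)).
  by rewrite /= scaler0 addr0.
apply: continuous_comp; last exact: cG.
by apply: cvg_pair; [exact: cvg_cst|exact: cvg_id].
Qed.

Lemma gradientE h k :
  gradient phi z (h, k) = gradient_x phi z h + gradient_y phi z k.
Proof.
rewrite /gradient_x /gradient_y.
have [L [-> _]] := dual_linearPZ gradient_dual.
by rewrite -linearD; congr (L (_, _)); rewrite /= ?addr0 ?add0r.
Qed.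

Lemma gen_comp_fin_num : \forall x \near xbar, gen_comp phi g x \is a fin_num.
Proof. by have [+ _] := dphi; exact: calm_cvg_graph. Qed.

(** The expansion of [phi] at [z] is pulled back along [x |-> (x, g x)], which tends to [z] by
    calmness. *)
Lemma gen_comp_near (e : R) : 0 < e -> \forall x \near xbar,
  `|fine (gen_comp phi g x) - fine (gen_comp phi g xbar)
    - gradient_x phi z (x - xbar) - gradient_y phi z (g x - g xbar)|
  <= e * `|x - xbar|.
Proof.
move=> e0; have [l l0 gl] := calm_near g_calm.
have l1 : 0 < 1 + l by rewrite ltr_wpDr.
have [_ df] := dphi.
have el : 0 < e / (1 + l) by rewrite divr_gt0.
have H := calm_cvg_graph g_calm (differentiable_near df el).
near=> x.
have : `|fine (phi (x, g x)) - fine (phi z) - gradient phi z ((x, g x) - z)|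
    <= e / (1 + l) * `|(x, g x) - z| by near: x; exact: H.
rewrite -[(x, g x) - z]/(x - xbar, g x - g xbar) gradientE opprD addrA.
move=> /le_trans; apply.
(* The norm of the pair is now the maximum norm; each component is at most
   [(1 + l) * |x - xbar|]. *)
rewrite mulrAC ler_pdivrMr// -mulrA ler_wpM2l ?(ltW e0)// prod_normE /= ge_max.
rewrite mulrDr mulr1 lerDl mulr_ge0//=.
have : `|g x - g xbar| <= l * `|x - xbar| by near: x.
by have := normr_ge0 (x - xbar); lra.
Unshelve. all: by end_near. Qed.

(** Calmness of the composition, which the singular subdifferential requires. *)
Lemma gen_comp_lipschitz : exists2 M : R, 0 < M & \forall x \near xbar,
  `|fine (gen_comp phi g x) - fine (gen_comp phi g xbar)| <= M * `|x - xbar|.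
Proof.
have [l l0 gl] := calm_near g_calm.
have [A A0 HA] := dual_bounded gradient_x_dual.
have [B B0 HB] := dual_bounded gradient_y_dual.
(* The summands bound the remainder (taken with [e = 1]), the [x]-gradient term, and the
   [y]-gradient term through calmness of [g]. *)
exists (1 + A + B * l).
  by rewrite -addrA ltr_wpDr// addr_ge0 ?(ltW A0)// mulr_ge0// ltW.
near=> x.
have : `|fine (gen_comp phi g x) - fine (gen_comp phi g xbar)
    - gradient_x phi z (x - xbar) - gradient_y phi z (g x - g xbar)|
  <= 1 * `|x - xbar| by near: x; exact: gen_comp_near.
have : B * `|g x - g xbar| <= B * (l * `|x - xbar|).
  by rewrite ler_wpM2l ?(ltW B0)//; near: x.
have := HB (g x - g xbar); have := HA (x - xbar).
rewrite !mulrDl mul1r -mulrA.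
rewrite !ler_norml; lra.
Unshelve. all: by end_near. Qed.

End composition.

(** * Singular subgradients and the main result *)

(** Testing along the ray [zbar + t *: z] with small [t > 0] and cancelling [t] gives [L z <= 0];
    applying this to [- z] gives equality. *)
Lemma dual_eq0 (R : realType) (Z : normedModType R) (zs : Z -> R^o) (zbar : Z) :
  dual zs ->
  (forall e : R, 0 < e -> \forall z \near zbar,
    zs (z - zbar) <= e * `|z - zbar|) ->
  zs = (fun=> 0).
Proof.
move=> /dual_linearPZ[L [-> _]] H.
suff L0 z : L z <= 0.
  apply/funext => z; apply/eqP; rewrite eq_le L0 /=.
  by have := L0 (- z); rewrite linearN oppr_le0.
apply/ler_addgt0Pr => e e0; rewrite add0r.
(* With this tolerance the bound [e / (|z| + 1) * |z|] is at most [e], including for [z = 0]. *)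
have e1 : 0 < e / (`|z| + 1) by rewrite divr_gt0// ltr_wpDl.
have cvgz : zbar + t *: z @[t --> (0 : R)] --> zbar.
  rewrite -[X in _ --> X]addr0 -(scale0r z).
  by apply: cvgD; [exact: cvg_cst|apply: cvgZr_tmp; exact: cvg_id].
have /(cvgz _) := H _ e1.
move=> /nbhs_ballP[r /= r0 Hr].
have := Hr (r / 2).
rewrite -ball_normE /ball_ /= sub0r normrN gtr0_norm ?divr_gt0//.
rewrite ltr_pdivrMr// ltr_pMr// ltr1n => /(_ isT).
rewrite addrAC subrr add0r linearZ normrZ /= -[_ *: L z]/(_ * _).
rewrite gtr0_norm ?divr_gt0// mulrCA ler_pM2l ?divr_gt0// => /le_trans; apply.
by rewrite mulrAC ler_pdivrMr ?ltr_wpDl// ler_pM2l// lerDl.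
Qed.

(* The graph of [f] lies in its epigraph, so restricting the normality
   inequality to it and using calmness forces the functional to be [o(h)]. *)
Lemma singular_regular_subdiff_lipschitz (R : realType) (Z : normedModType R)
    (f : Z -> \bar R) (zbar : Z) (M : R) :
  0 < M ->
  (\forall z \near zbar, f z \is a fin_num) ->
  (\forall z \near zbar,
    `|fine (f z) - fine (f zbar)| <= M * `|z - zbar|) ->
  singular_regular_subdiff f zbar = [set (fun _ : Z => 0)].
Proof.
move=> M0 ffin fM; apply/seteqP; split=> zs.
  move=> [dzs /regular_normal_coneP[_ Hzs]] /=.
  apply: (@dual_eq0 _ _ _ zbar) => // e e0.
  (* Seen as a calm map, [fine \o f] has a graph point that tends to the base point, so the
     normality inequality can be evaluated there. *)
  have f_calm : calm (fine \o f : Z -> R^o) zbar.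
    move/nbhs_ballP: fM => [r r0 Hr]; exists r, M; split=> //; exact: ltW.
  have M1 : 0 < 1 + M by rewrite addr_gt0.
  have eM : 0 < e / (1 + M) by rewrite divr_gt0.
  have H := calm_cvg_graph f_calm (Hzs _ eM).
  near=> z.
  have : epi f (z, fine (f z) : R^o) ->
     zs (z - zbar) + 0 <= e / (1 + M) * (`|z - zbar| + `|fine (f z) - fine (f zbar)|).
    near: z; exact: H.
  rewrite /epi /= fineK ?lexx; last by near: z.
  rewrite addr0 => /(_ isT)/le_trans; apply.
  rewrite mulrAC ler_pdivrMr// -mulrA ler_wpM2l ?(ltW e0)//.
  by rewrite mulrDr mulr1 lerD2l mulrC; near: z.
move=> /= ->; split; first exact: dual0.
apply/regular_normal_coneP; split.
  by apply: dual_dual_pair; exact: dual0.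
move=> e e0; near=> w => _; rewrite /dual_pair addr0.
by rewrite mulr_ge0 ?(ltW e0)// addr_ge0.
Unshelve. all: by end_near. Qed.

Unset Implicit Arguments.

Theorem theorem5p1 (R : realType) (X Y : normedModType R)
    (g : X -> Y) (xbar : X) (ybar : Y) (phi : X * Y -> \bar R)
    (hcalm : calm g xbar)
    (hybar : ybar = g xbar)
    (hphi : forall z, phi z <> -oo%E)
    (hfin : phi (xbar, ybar) \is a fin_num)
    (hdiff : ediff phi (xbar, ybar)) :
  [/\ regular_subdiff (gen_comp phi g) xbar =
        translate (gradient_x phi (xbar, ybar))
          (regular_coderiv g xbar (gradient_y phi (xbar, ybar))),
      translate (gradient_x phi (xbar, ybar))
          (regular_coderiv g xbar (gradient_y phi (xbar, ybar))) =
        translate (gradient_x phi (xbar, ybar))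
          (regular_subdiff
             (scalarization (gradient_y phi (xbar, ybar)) g) xbar) &
      singular_regular_subdiff (gen_comp phi g) xbar =
        [set (fun _ : X => 0)]].
Proof.
subst ybar.
have ffin := gen_comp_fin_num hcalm hdiff.
have dgy := gradient_y_dual hdiff.
have codE := regular_coderiv_scalarization hcalm dgy.
have [M M0 fM] := gen_comp_lipschitz hcalm hdiff.
(* Rewriting the coderivative as a subdifferential makes the second equality trivial and leaves the
   first as a translation with [h] the scalarized [g]. *)
split; rewrite ?codE//; last exact: singular_regular_subdiff_lipschitz M0 ffin fM.
apply: regular_subdiff_translate => //; first exact: gradient_x_dual.
move=> e e0; apply: filterS (gen_comp_near hcalm hdiff e0) => x.
by have [L [-> _]] := dual_linearPZ dgy; rewrite linearB.
Qed.
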